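(* Let $\Phi$ be a function on CP problems such that for each CP problem $(\mathcal{R}/\mathcal{S},L)$: if there are TRSs $\mathcal{R}_1,\mathcal{R}_2$ with $\mathcal{R}=\mathcal{R}_1\cup\mathcal{R}_2$ and a matrix interpretation $\mathcal{M}$ with constant growth such that $\mathcal{R}_1\subseteq\succsim^{\mathrm{ncp}}_{\mathcal{M}}$, $\mathcal{R}_2\subseteq\succ_{\mathcal{M}}$ and $\mathcal{S}\subseteq\succsim_{\mathcal{M}}$, then $\Phi(\mathcal{R}/\mathcal{S},L)=\{(\mathcal{R}_1/(\mathcal{R}_2\cup\mathcal{S}),L,f)\}$ for some such $\mathcal{R}_1,\mathcal{R}_2$, where $f(n)=n$; otherwise $\Phi(\mathcal{R}/\mathcal{S},L)=\{(\mathcal{R}/\mathcal{S},L,\mathbf{0})\}$. Then $\Phi$ is a sound CP processor.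
   Context: A matrix interpretation $\mathcal{M}$ of dimension $d$ interprets each $n$-ary $f$ as $f_{\mathcal{M}}(\vec x_1,\dots,\vec x_n)=F_1\vec x_1+\dots+F_n\vec x_n+\vec f$, $F_i\in\mathbb{N}^{d\times d}$, $\vec f\in\mathbb{N}^d$, $(F_i)_{(1,1)}\ge1$. On $\mathbb{N}^d$: $\succsim$ is pointwise $\ge$; $\vec u\succ\vec v$ iff $u_1>v_1$ and $\vec u\succsim\vec v$. $s\succ_{\mathcal{M}}t$ ($s\succsim_{\mathcal{M}}t$) iff $[\alpha]_{\mathcal{M}}(s)\succ[\alpha]_{\mathcal{M}}(t)$ ($\succsim$) for all assignments $\alpha$. Constant growth: there is a matrix $A$ with $M_1\cdots M_p\le A$ for all $p$ and all matrices $M_1,\dots,M_p$ occurring in $\mathcal{M}$. Writing $[\alpha]_{\mathcal{M}}(s)=S_1\alpha(x_1)+\dots+S_k\alpha(x_k)+\vec s$ (variables of $s,t$ among $x_1,\dots,x_k$), the non-constant part is $S_1\alpha(x_1)+\dots+S_k\alpha(x_k)$, and $s\succsim^{\mathrm{ncp}}_{\mathcal{M}}t$ iff the non-constant part of $s$ is $\succsim$ that of $t$ for all $\alpha$. $\to_{\mathcal{R}/\mathcal{S}}=\to_{\mathcal{S}}^*\cdot\to_{\mathcal{R}}\cdot\to_{\mathcal{S}}^*$; $\mathrm{cp}(n,\to,L)=\sup\{\mathrm{dl}(t,\to)\mid t\in L,|t|\le n\}$ with $\mathrm{dl}(t,\to)=\sup\{m\mid\exists u,t\to^mu\}$. A CP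 problem is a pair $(\mathcal{R}/\mathcal{S},L)$ of a relative TRS and a set of terms. A CP processor maps a CP problem to a finite set of triples $(\mathcal{R}_i/\mathcal{S}_i,L_i,f_i)$ with $f_i:\mathbb{N}\to\mathbb{N}$; it is sound if $\mathrm{cp}(n,\to_{\mathcal{R}/\mathcal{S}},L)=O(\sum_i f_i(n)+\sum_i\mathrm{cp}(n,\to_{\mathcal{R}_i/\mathcal{S}_i},L_i))$ for every input. $\mathbf{0}$ is the zero function.
   Formalization: TRSs are taken to be finite sets of rules; for infinite TRSs the claim fails, e.g. R1 = {a -> s^i(0) | i in N}, R2 = {s(x) -> x}, S empty, L = {a}, with s interpreted as x+1. *)

(* Defs.v *)
From HB Require Import structures.
From Stdlib Require Import Relations.
From mathcomp Require Import all_boot all_order all_algebra.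
From mathcomp Require Import boolp classical_sets functions cardinality fsbigop.
From mathcomp Require Import reals constructive_ereal ereal.

Set Implicit Arguments.
Unset Strict Implicit.
Unset Printing Implicit Defensive.

Import Order.TTheory GRing.Theory Num.Theory.
Local Open Scope classical_set_scope.
Local Open Scope ring_scope.

(* First-order terms over a signature F with arities ar and variables V.      *)
(* Argument lists are finite functions: every term is well-formed, and equal  *)
(* argument lists are Leibniz equal.                                          *)
Inductive term (F : Type) (ar : F -> nat) (V : eqType) : Type :=
| Var of V
| Fun (f : F) of {ffun 'I_(ar f) -> term ar V}.
Arguments Var {F ar V}.
Arguments Fun {F ar V}.

Section Terms.
Context {F : Type} {ar : F -> nat} {V : eqType}.
Local Notation term := (term ar V).
Implicit Types (t : term) (f : F) (x : V).

(* The automatically generated principle has no hypothesis on arguments. *)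
Lemma term_rect_args (P : term -> Prop) :
  (forall x, P (Var x)) ->
  (forall f (ts : {ffun 'I_(ar f) -> term}),
     (forall i, P (ts i)) -> P (Fun f ts)) ->
  forall t, P t.
Proof.
move=> PV PF; fix rec 1; case=> [x|f ts]; first exact: PV.
by apply: PF => i; apply: rec.
Qed.

(* Number of symbol occurrences, variables included. *)
Fixpoint term_size t : nat :=
  match t with
  | Var _ => 1
  | Fun f ts => (\sum_(i < ar f) term_size (ts i)).+1
  end.

Fixpoint term_vars t : seq V :=
  match t with
  | Var x => [:: x]
  | Fun f ts => flatten [seq term_vars (ts i) | i <- enum 'I_(ar f)]
  end.

Fixpoint subst (sigma : V -> term) t : term :=
  match t with
  | Var x => sigma x
  | Fun f ts => Fun f [ffun i => subst sigma (ts i)]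
  end.

Definition wf_rule (rho : term * term) : Prop :=
  (forall x, rho.1 <> Var x) /\ {subset term_vars rho.2 <= term_vars rho.1}.

(* Finite sets of rewrite rules. *)
Record trs : Type := TRS {
  rules :> set (term * term);
  rules_finite : finite_set rules;
  rules_wf : forall rho, rules rho -> wf_rule rho
}.

Lemma rulesU_wf (R S : trs) rho : (rules R `|` rules S) rho -> wf_rule rho.
Proof. by case; apply: rules_wf. Qed.

Lemma rulesU_finite (R S : trs) : finite_set (rules R `|` rules S).
Proof. by rewrite finite_setU; split; apply: rules_finite. Qed.

Definition trsU (R S : trs) : trs :=
  TRS (rulesU_finite R S) (@rulesU_wf R S).

Inductive rewrite_step (R : trs) : term -> term -> Prop :=
| RewriteRoot l r sigma :
    rules R (l, r) -> rewrite_step R (subst sigma l) (subst sigma r)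
| RewriteArg f (ts us : {ffun 'I_(ar f) -> term}) (i : 'I_(ar f)) :
    rewrite_step R (ts i) (us i) ->
    (forall j, j != i -> ts j = us j) ->
    rewrite_step R (Fun f ts) (Fun f us).

Definition relative_step (R S : trs) (s t : term) : Prop :=
  exists s' t', [/\ clos_refl_trans term (rewrite_step S) s s',
                    rewrite_step R s' t' &
                    clos_refl_trans term (rewrite_step S) t' t].

Fixpoint steps (rel : term -> term -> Prop) (m : nat) (s t : term) : Prop :=
  if m is m'.+1 then exists2 u, rel s u & steps rel m' u t else s = t.

End Terms.

Arguments trs {F} ar V.

(* Complexity measures take values in N u {oo}, embedded in \bar K. *)
Section Complexity.
Context (K : realType) {F : Type} {ar : F -> nat} {V : eqType}.
Local Notation term := (term ar V).
Local Open Scope ereal_scope.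

Definition dl (t : term) (rel : term -> term -> Prop) : \bar K :=
  ereal_sup [set m%:R%:E | m in [set m : nat | exists u, steps rel m t u]].

(* Adjoining 0 makes the supremum of the empty set 0, as in N u {oo}, instead *)
(* of -oo.                                                                    *)
Definition cp (n : nat) (rel : term -> term -> Prop) (L : set term) : \bar K :=
  ereal_sup (0 |` [set dl t rel | t in [set t | L t /\ (term_size t <= n)%N]]).

Definition big_O (g h : nat -> \bar K) : Prop :=
  exists C N : nat, forall n, (N <= n)%N -> g n <= C%:R%:E * h n.

End Complexity.

Record cp_problem (F : Type) (ar : F -> nat) (V : eqType) : Type := CPProblem {
  strict_trs : trs ar V;
  weak_trs : trs ar V;
  start_terms : set (term ar V)
}.

(* Finite sums over sets are indexed by a choiceType. *)
HB.instance Definition _ F (ar : F -> nat) (V : eqType) :=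
  gen_eqMixin (cp_problem ar V).
HB.instance Definition _ F (ar : F -> nat) (V : eqType) :=
  gen_choiceMixin (cp_problem ar V).

Section Processors.
Context {F : Type} {ar : F -> nat} {V : eqType}.
Local Notation cp_problem := (cp_problem ar V).

(* An element (P, f) stands for the triple (R/S, L, f) with P = (R/S, L). *)
Definition processor_map : Type := cp_problem -> set (cp_problem * (nat -> nat)).

Definition is_processor (Phi : processor_map) : Prop :=
  forall P, finite_set (Phi P).

Definition cp_of (K : realType) (P : cp_problem) (n : nat) : \bar K :=
  cp K n (relative_step (strict_trs P) (weak_trs P)) (start_terms P).

Definition sound (K : realType) (Phi : processor_map) : Prop :=
  forall P, big_O (cp_of K P)
    (fun n => (\sum_(q \in Phi P) ((q.2 n)%:R : K)%:E)
              + (\sum_(q \in Phi P) cp_of K q.1 n))%E.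

End Processors.

(* The dimension is d.+1; the index ord0 is the first component. *)
Record matrix_interp (F : Type) (ar : F -> nat) (d : nat) : Type := MatrixInterp {
  mi_mx : forall f : F, 'I_(ar f) -> 'M[nat]_d.+1;
  mi_vec : F -> 'cV[nat]_d.+1;
  mi_mx11 : forall f i, (1 <= mi_mx (f := f) i ord0 ord0)%N
}.

Definition mx_ge (m n : nat) (A B : 'M[nat]_(m, n)) : Prop :=
  forall i j, (B i j <= A i j)%N.

Definition vec_gt (d : nat) (u v : 'cV[nat]_d.+1) : Prop :=
  (v ord0 ord0 < u ord0 ord0)%N /\ mx_ge u v.

Section Interpretation.
Context {F : Type} {ar : F -> nat} {V : eqType} {d : nat}.
Variable M : matrix_interp ar d.
Local Notation term := (term ar V).
Local Notation assignment := (V -> 'cV[nat]_d.+1).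

Fixpoint interp (alpha : assignment) (t : term) : 'cV[nat]_d.+1 :=
  match t with
  | Var x => alpha x
  | Fun f ts =>
      \sum_(i < ar f) mi_mx M i *m interp alpha (ts i) + mi_vec M f
  end.

(* interp alpha t = \sum_x coef x t *m alpha x + const t, see interpE. *)
Fixpoint coef (x : V) (t : term) : 'M[nat]_d.+1 :=
  match t with
  | Var y => if x == y then 1%:M else 0
  | Fun f ts => \sum_(i < ar f) mi_mx M i *m coef x (ts i)
  end.

Fixpoint const (t : term) : 'cV[nat]_d.+1 :=
  match t with
  | Var _ => 0
  | Fun f ts => \sum_(i < ar f) mi_mx M i *m const (ts i) + mi_vec M f
  end.

Definition noncst (alpha : assignment) (t : term) : 'cV[nat]_d.+1 :=
  \sum_(x <- undup (term_vars t)) coef x t *m alpha x.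

Lemma interp_seq (xs : seq V) alpha t : uniq xs -> {subset term_vars t <= xs} ->
  interp alpha t = \sum_(x <- xs) coef x t *m alpha x + const t.
Proof.
move=> Uxs; elim/(@term_rect_args F ar V): t => [y|f ts IH] /= sub.
  have yxs : y \in xs by apply: sub; rewrite inE.
  rewrite addr0 (bigD1_seq y) //= eqxx mul1mx big1 ?addr0 // => x /negPf->.
  by rewrite mul0mx.
rewrite addrA; congr (_ + _).
under [X in _ = X + _]eq_bigr do rewrite mulmx_suml.
rewrite exchange_big -big_split /=; apply: eq_bigr => i _.
rewrite IH; last first.
  move=> x xi; apply: sub; apply/flatten_mapP.
  by exists i => //; rewrite mem_enum.
rewrite mulmxDr mulmx_sumr; congr (_ + _).
by apply: eq_bigr => x _; rewrite mulmxA.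
Qed.

Lemma interpE alpha t : interp alpha t = noncst alpha t + const t.
Proof.
by apply: interp_seq (undup_uniq _) _ => x; rewrite mem_undup.
Qed.

Definition term_ge (s t : term) : Prop :=
  forall alpha, mx_ge (interp alpha s) (interp alpha t).

Definition term_gt (s t : term) : Prop :=
  forall alpha, vec_gt (interp alpha s) (interp alpha t).

Definition term_ge_ncp (s t : term) : Prop :=
  forall alpha, mx_ge (noncst alpha s) (noncst alpha t).

Definition occurs_mx (A : 'M[nat]_d.+1) : Prop :=
  exists f (i : 'I_(ar f)), A = mi_mx M i.

Definition constant_growth : Prop :=
  exists A : 'M[nat]_d.+1, forall Ms : seq 'M[nat]_d.+1,
    (forall B, B \in Ms -> occurs_mx B) -> mx_ge A (\prod_(B <- Ms) B).

Definition oriented_by (rel : term -> term -> Prop) (R : trs ar V) : Prop :=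
  forall l r, rules R (l, r) -> rel l r.

End Interpretation.

Definition weight_gap_split (F : Type) (ar : F -> nat) (V : eqType)
    (R S R1 R2 : trs ar V) : Prop :=
  R = trsU R1 R2 /\
  exists (d : nat) (M : matrix_interp ar d),
    [/\ constant_growth M,
        oriented_by (term_ge_ncp M) R1,
        oriented_by (term_gt M) R2 &
        oriented_by (term_ge M) S].

(* Main.v *)
(** Evaluate terms under the zero assignment and let [weight t] be the first
    component of the value of [t].  An S-step does not increase the weight, an
    R2-step decreases it, and an R1-step increases it by at most a constant
    [D]: the right-hand side exceeds the left-hand side by at most its constant
    part, which a context multiplies by a product of matrices of M, bounded by
    constant growth.  A derivation from [t] with [k] R1-steps thus has at most
    [weight t + (D + 1) * k] R-steps.  Constant growth also gives
    [weight t = O(|t|)], once the constant vectors of M are bounded; the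
    signature may be infinite, but resetting to 0 the large vectors, none of
    which belongs to a symbol of the finitely many rules, achieves this. *)

Require Import Defs.
From Stdlib Require Import Relations.
From mathcomp Require Import all_boot all_order all_algebra.
From mathcomp Require Import boolp classical_sets functions cardinality fsbigop.
From mathcomp Require Import reals constructive_ereal ereal.
From mathcomp Require Import zify.

Set Implicit Arguments.
Unset Strict Implicit.
Unset Printing Implicit Defensive.

(* [functions] also has a [Fun]. *)
Import Defs.
Import Order.TTheory GRing.Theory Num.Theory.
Local Open Scope classical_set_scope.

(** * Monotonicity of matrix operations for the componentwise order *)

Section MatrixOrder.
Local Open Scope ring_scope.

Lemma mx_ge_refl m n (A : 'M[nat]_(m, n)) : mx_ge A A.
Proof. by move=> i j. Qed.

Lemma mx_ge_trans m n (A B C : 'M[nat]_(m, n)) :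
  mx_ge A B -> mx_ge B C -> mx_ge A C.
Proof. by move=> AB BC i j; apply: leq_trans (BC i j) (AB i j). Qed.

Lemma mx_ge_add m n (A B C D : 'M[nat]_(m, n)) :
  mx_ge A B -> mx_ge C D -> mx_ge (A + C) (B + D).
Proof. by move=> AB CD i j; rewrite !mxE; apply: leq_add. Qed.

Lemma mx_ge_addr m n (A B : 'M[nat]_(m, n)) : mx_ge (A + B) A.
Proof. by move=> i j; rewrite mxE; apply: leq_addr. Qed.

Lemma mx_ge_sum m n (I : Type) (r : seq I) (A B : I -> 'M[nat]_(m, n)) :
  (forall i, mx_ge (A i) (B i)) -> mx_ge (\sum_(i <- r) A i) (\sum_(i <- r) B i).
Proof.
by move=> AB; apply: big_ind2 => // *; apply: mx_ge_add.
Qed.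

Lemma mx_ge_mul m n p (A B : 'M[nat]_(m, n)) (C D : 'M[nat]_(n, p)) :
  mx_ge A B -> mx_ge C D -> mx_ge (A *m C) (B *m D).
Proof.
move=> AB CD i j; rewrite !mxE.
apply: (big_ind2 (fun x y => (y <= x)%N)) => // [*|k _]; first exact: leq_add.
exact: leq_mul.
Qed.

End MatrixOrder.

(** * Effect of rewrite steps on values, and growth of values with term size *)

Section Interp.
Context {F : Type} {ar : F -> nat} {V : eqType} {d : nat}.
Variable M : matrix_interp ar d.
Local Notation term := (term ar V).
Implicit Types (s t u : term) (alpha : V -> 'cV[nat]_d.+1) (R S : trs ar V).
Local Open Scope ring_scope.

Lemma interp_subst alpha (sigma : V -> term) t :
  interp M alpha (subst sigma t) = interp M (fun x => interp M alpha (sigma x)) t.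
Proof.
elim/(@term_rect_args F ar V): t => //= f ts IH; congr (_ + _).
by apply: eq_bigr => i _; rewrite ffunE IH.
Qed.

(** A one-hole context acts as an affine map: the arguments off position [i] agree, so they
    contribute the same [C] on both sides. *)
Lemma interp_arg alpha f (ts us : {ffun 'I_(ar f) -> term}) (i : 'I_(ar f)) :
  (forall j, j != i -> ts j = us j) -> exists C,
    interp M alpha (Fun f ts) = mi_mx M i *m interp M alpha (ts i) + C /\
    interp M alpha (Fun f us) = mi_mx M i *m interp M alpha (us i) + C.
Proof.
move=> E.
exists (\sum_(j < ar f | j != i) mi_mx M j *m interp M alpha (ts j) + mi_vec M f).
split; rewrite /= (bigD1 i) //= -addrA //.
by congr (_ + (_ + _)); apply: eq_bigr => j /E ->.
Qed.

Lemma rewrite_step_ge R alpha s t : oriented_by (term_ge M) R ->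
  rewrite_step R s t -> mx_ge (interp M alpha s) (interp M alpha t).
Proof.
move=> RM; elim=> [l r sigma /RM lr|f ts us i _ IH E].
  by rewrite !interp_subst; apply: lr.
have [C [-> ->]] := interp_arg alpha E.
by apply: mx_ge_add (mx_ge_refl _); apply: mx_ge_mul.
Qed.

Lemma rewrite_steps_ge R alpha s t : oriented_by (term_ge M) R ->
  clos_refl_trans term (rewrite_step R) s t ->
  mx_ge (interp M alpha s) (interp M alpha t).
Proof.
move=> RM; elim=> [u v|u|u v w _ IH1 _ IH2]; first exact: rewrite_step_ge.
  exact: mx_ge_refl.
exact: mx_ge_trans IH1 IH2.
Qed.

(** The strict drop in the first component survives because it is scaled by the positive corner
    entry of [A]; the other summands do not increase. *)
Lemma vec_gt_mul (A : 'M[nat]_d.+1) (u v : 'cV[nat]_d.+1) :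
  (0 < A ord0 ord0)%N -> vec_gt u v -> vec_gt (A *m u) (A *m v).
Proof.
move=> A0 [uv0 uv]; split; last exact: mx_ge_mul (mx_ge_refl _) uv.
rewrite !mxE (bigD1 ord0) //= [ltnRHS](bigD1 ord0) //= -addSn; apply: leq_add.
  by rewrite ltn_pmul2l.
apply: (big_ind2 (fun x y => (x <= y)%N)) => // [*|k _]; first exact: leq_add.
exact: leq_mul (uv _ _).
Qed.

Lemma rewrite_step_gt R alpha s t : oriented_by (term_gt M) R ->
  rewrite_step R s t -> vec_gt (interp M alpha s) (interp M alpha t).
Proof.
move=> RM; elim=> [l r sigma /RM lr|f ts us i _ IH E].
  by rewrite !interp_subst; apply: lr.
have [C [-> ->]] := interp_arg alpha E.
have [gt0 ge] := vec_gt_mul (mi_mx11 M i) IH.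
split; first by rewrite !mxE ltn_add2r; move: gt0; rewrite !mxE.
exact: mx_ge_add (mx_ge_refl _).
Qed.

(** [Ms] lists the matrices on the path from the root to the redex. At the redex the non-constant
    part does not grow, so the excess is at most [const r]; the context multiplies it by the path
    product. *)
Lemma rewrite_step_ncp R alpha s t : oriented_by (term_ge_ncp M) R ->
  rewrite_step R s t -> exists (Ms : seq 'M[nat]_d.+1) l r,
    [/\ forall B, B \in Ms -> occurs_mx M B, rules R (l, r) &
        mx_ge (interp M alpha s + \prod_(B <- Ms) B *m const M r)
              (interp M alpha t)].
Proof.
move=> RM; elim=> [l r sigma lrR|f ts us i _ [Ms [l [r [occ lrR IH]]]] E].
  exists [::], l, r; split => //; rewrite big_nil mul1mx !interp_subst !interpE.
  apply: mx_ge_add (mx_ge_refl _).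
  exact: mx_ge_trans (mx_ge_addr _ _) (RM _ _ lrR _).
exists (mi_mx M i :: Ms), l, r; split => // [B|].
  by rewrite inE => /predU1P[->|/occ//]; exists f, i.
have [C [-> ->]] := interp_arg alpha E.
rewrite big_cons -mulmxA addrAC -mulmxDr.
by apply: mx_ge_add (mx_ge_refl _); apply: mx_ge_mul IH.
Qed.

Lemma interp0_bound (A : 'M[nat]_d.+1) (c : 'cV[nat]_d.+1) :
  (forall Ms : seq 'M[nat]_d.+1,
     (forall B, B \in Ms -> occurs_mx M B) -> mx_ge A (\prod_(B <- Ms) B)) ->
  (forall f, mx_ge c (mi_vec M f)) ->
  forall t, mx_ge ((A *m c) *+ term_size t) (interp M (fun=> 0) t).
Proof.
move=> MA Mc t.
(* Generalizing over the path product above [t] lets [A] bound each whole path once; bounding level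
   by level would accumulate powers of [A]. *)
suff H (Ms : seq 'M[nat]_d.+1) : (forall B, B \in Ms -> occurs_mx M B) ->
    mx_ge ((A *m c) *+ term_size t) (\prod_(B <- Ms) B *m interp M (fun=> 0) t).
  by have := H [::]; rewrite big_nil mul1mx; apply.
elim/(@term_rect_args F ar V): t Ms => [x|f ts IH] Ms occ /=.
  by rewrite mulmx0 => i j; rewrite mxE.
rewrite mulmxDr mulmx_sumr mulrSr.
apply: mx_ge_add; last exact: mx_ge_mul (MA _ occ) (Mc f).
rewrite -sumrMnr; apply: mx_ge_sum => i; rewrite mulmxA.
have := IH i (rcons Ms (mi_mx M i)); rewrite -cats1 big_cat big_seq1; apply => B.
by rewrite mem_cat mem_seq1 => /orP[/occ//|/eqP->]; exists f, i.
Qed.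

End Interp.

(** * Truncating large constant vectors *)

Section ClipVectors.
Context {F : Type} {ar : F -> nat} {V : eqType} {d : nat}.
Variable M : matrix_interp ar d.
Local Notation term := (term ar V).

Definition vec_max (f : F) : nat := \max_(i < d.+1) mi_vec M f i ord0.

Fixpoint term_vec_max (t : term) : nat :=
  match t with
  | Var _ => 0
  | Fun f ts => maxn (vec_max f) (\max_(i < ar f) term_vec_max (ts i))
  end.

(** The matrices are kept, so constant growth and non-constant parts are those of [M]. *)
Definition clip_vec (N : nat) : matrix_interp ar d :=
  MatrixInterp (fun f => if vec_max f <= N then mi_vec M f else 0%R)
    (@mi_mx11 _ _ _ M).

Lemma interp_clip_vec N alpha t : term_vec_max t <= N ->
  interp (clip_vec N) alpha t = interp M alpha t.
Proof.
elim/(@term_rect_args F ar V): t => //= f ts IH.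
rewrite geq_max => /andP[-> /bigmax_leqP tsN]; congr (_ + _)%R.
by apply: eq_bigr => i _; rewrite IH ?tsN.
Qed.

Lemma clip_vec_le N f : mx_ge (const_mx N) (mi_vec (clip_vec N) f).
Proof.
move=> i j; rewrite mxE /= (ord1 j); case: ifP => [|_]; last by rewrite mxE.
by apply: leq_trans; apply: (@leq_bigmax _ (fun i => mi_vec M f i ord0)).
Qed.

End ClipVectors.

Lemma finite_set_bounded (T : Type) (A : set T) (f : T -> nat) :
  finite_set A -> exists N, forall x, A x -> f x <= N.
Proof.
move=> /(finite_image f) /finite_seqP[s fAs]; exists (\max_(i <- s) i) => x Ax.
have : (f @` A) (f x) by exists x.
by rewrite fAs => fxs; apply: leq_bigmax_seq.
Qed.

(** * Counting strict steps in relative derivations *)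

Section RelativeSteps.
Context {F : Type} {ar : F -> nat} {V : eqType}.
Local Notation term := (term ar V).
Implicit Types (R S : trs ar V) (s t u : term).

Lemma rewrite_step_sub R S s t : rules R `<=` rules S ->
  rewrite_step R s t -> rewrite_step S s t.
Proof.
by move=> RS; elim=> *; [apply/RewriteRoot/RS | apply: RewriteArg; eassumption].
Qed.

Lemma rewrite_steps_sub R S s t : rules R `<=` rules S ->
  clos_refl_trans term (rewrite_step R) s t ->
  clos_refl_trans term (rewrite_step S) s t.
Proof.
move=> RS; elim=> [u v uv|u|u v w _ uv _ vw].
- by apply: rt_step; apply: rewrite_step_sub uv.
- exact: rt_refl.
- exact: rt_trans uv vw.
Qed.

Lemma rewrite_stepU R S s t : rewrite_step (trsU R S) s t ->
  rewrite_step R s t \/ rewrite_step S s t.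
Proof.
elim=> [l r sigma [] lr|f ts us i _ [] IH E].
- by left; apply: RewriteRoot.
- by right; apply: RewriteRoot.
- by left; apply: RewriteArg IH E.
- by right; apply: RewriteArg IH E.
Qed.

(** The first relative step absorbs the preceding weak steps. For [k = 0] there is no such step, and
    the derivation is cut down to [s]; hence the end term may change. *)
Lemma relative_steps_prefix R S k s t u :
  clos_refl_trans term (rewrite_step S) s t ->
  steps (relative_step R S) k t u -> exists v, steps (relative_step R S) k s v.
Proof.
move=> st; case: k => [_|k [v [s' [t' [ts' s't' t'v]]] vu]]; first by exists s.
by exists u, v => //; exists s', t'; split => //; apply: rt_trans st ts'.
Qed.

Lemma relative_steps_split (R1 R2 S : trs ar V) (weight : term -> nat) (D : nat) :
  (forall s t, rewrite_step R1 s t -> weight t <= weight s + D) ->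
  (forall s t, rewrite_step R2 s t -> weight t < weight s) ->
  (forall s t, clos_refl_trans term (rewrite_step S) s t -> weight t <= weight s) ->
  forall m s t, steps (relative_step (trsU R1 R2) S) m s t ->
  exists k u, steps (relative_step R1 (trsU R2 S)) k s u /\
    m <= weight s + D.+1 * k.
Proof.
move=> w1 w2 wS; elim=> [|m IH] s t /=; first by exists 0, s.
case=> u [s' [t' [ss' s't' t'u]]] /IH[k [v [uv mk]]].
have subS : rules S `<=` rules (trsU R2 S) by move=> x; right.
have := wS _ _ ss'; have := wS _ _ t'u.
(* An [R1]-step is charged [D.+1]: one for itself and [D] for the weight it may add. An [R2]-step is
   paid for by the weight it removes. *)
have [st|st] := rewrite_stepU s't'.
  have := w1 _ _ st => h1 h2 h3; exists k.+1, v; split; last by nia.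
  exists u => //; exists s', t'.
  by split=> //; apply: rewrite_steps_sub subS _.
have := w2 _ _ st => h1 h2 h3.
(* The [R2]-step is weak in the target problem, so the whole step from [s] to [u] becomes a weak
   prefix of the remaining derivation. *)
have su : clos_refl_trans term (rewrite_step (trsU R2 S)) s u.
  apply: rt_trans (rewrite_steps_sub subS ss') _.
  apply: rt_trans (rewrite_steps_sub subS t'u).
  by apply: rt_step; apply: rewrite_step_sub st; move=> x; left.
have [v' sv'] := relative_steps_prefix su uv.
by exists k, v'; split=> //; nia.
Qed.

Lemma weight_gap_steps (R S R1 R2 : trs ar V) : weight_gap_split R S R1 R2 ->
  exists C : nat, forall m s t, steps (relative_step R S) m s t ->
  exists k u, steps (relative_step R1 (trsU R2 S)) k s u /\
    m <= C * (term_size s + k).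
Proof.
case=> -> [d [M [[A MA] R1M R2M SM]]].
(* Clipping at [N] spares every symbol of the rules, so both sides of each rule keep their
   values. *)
have [N RN] : exists N, forall rho,
    (rules R1 `|` (rules R2 `|` rules S)) rho ->
    maxn (term_vec_max M rho.1) (term_vec_max M rho.2) <= N.
  apply: finite_set_bounded.
  by rewrite !finite_setU; do !split; apply: rules_finite.
pose M' := clip_vec M N.
(* [A] dominates every path product, so [D] bounds the weight gained by an [R1]-step in any
   context. *)
have [D R1D] : exists D, forall rho, rules R1 rho ->
    (A *m const M' rho.2)%R ord0 ord0 <= D.
  by apply: finite_set_bounded; apply: rules_finite.
have eqI l r alpha : (rules R1 `|` (rules R2 `|` rules S)) (l, r) ->
    interp M' alpha l = interp M alpha l /\ interp M' alpha r = interp M alpha r.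
  by move=> /RN /=; rewrite geq_max => /andP[lN rN]; rewrite !interp_clip_vec.
have R2M' : oriented_by (term_gt M') R2.
  move=> l r lr alpha; have [|-> ->] := eqI l r alpha; first by right; left.
  exact: R2M.
have SM' : oriented_by (term_ge M') S.
  move=> l r lr alpha; have [|-> ->] := eqI l r alpha; first by right; right.
  exact: SM.
(* [noncst] involves only matrices, which clipping leaves alone. *)
have R1M' : oriented_by (term_ge_ncp M') R1 by exact: R1M.
pose weight (t : term) := interp M' (fun=> 0%R) t ord0 ord0.
pose c := (A *m const_mx N : 'cV[nat]_d.+1)%R ord0 ord0.
have weightE t : weight t <= c * term_size t.
  have := interp0_bound (M := M') MA (clip_vec_le M N) t ord0 ord0.
  by rewrite mulmxnE -mulr_natr natn.
have split := @relative_steps_split R1 R2 S weight D.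
exists (c + D.+1) => m s t st.
have [|||k [u [su mk]]] := split _ _ _ m s t st.
- move=> u v /(rewrite_step_ncp (fun=> 0%R) R1M')[Ms [l [r [occ lr uv]]]].
  apply: leq_trans (uv ord0 ord0) _; rewrite mxE leq_add2l.
  apply: leq_trans (R1D _ lr).
  exact: mx_ge_mul (MA _ occ) (mx_ge_refl _) _ _.
- by move=> u v /(rewrite_step_gt (fun=> 0%R) R2M')[].
- by move=> u v /(rewrite_steps_ge (fun=> 0%R) SM'); apply.
exists k, u; split=> //; have := weightE s; nia.
Qed.

End RelativeSteps.

(** * From derivation lengths to complexity functions *)

Section Complexity.
Context (K : realType) {F : Type} {ar : F -> nat} {V : eqType}.
Local Notation term := (term ar V).
Local Open Scope ereal_scope.

Lemma cp_ge0 n (rel : term -> term -> Prop) L : 0 <= cp K n rel L.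
Proof. by apply: ereal_sup_ubound; left. Qed.

Lemma le_cp n (rel : term -> term -> Prop) (L : set term) k t u :
  L t -> (term_size t <= n)%N -> steps rel k t u -> k%:R%:E <= cp K n rel L.
Proof.
move=> Lt tn tu; apply: (@le_trans _ _ (dl K t rel)).
  by apply: ereal_sup_ubound; exists k => //; exists u.
by apply: ereal_sup_ubound; right; exists t.
Qed.

(** The bound [0 <= x] handles the 0 adjoined to the supremum. *)
Lemma cp_le n (rel : term -> term -> Prop) (L : set term) (x : \bar K) :
  0 <= x ->
  (forall m t u, L t -> (term_size t <= n)%N -> steps rel m t u -> m%:R%:E <= x) ->
  cp K n rel L <= x.
Proof.
move=> x0 H; apply: ge_ereal_sup => _ [->//|[t [Lt tn] <-]].
by apply: ge_ereal_sup => _ [m [u tu] <-]; apply: H tu.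
Qed.

Lemma weight_gap_cp (R S R1 R2 : trs ar V) (L : set term) :
  weight_gap_split R S R1 R2 -> exists C : nat, forall n,
    cp K n (relative_step R S) L <=
      C%:R%:E * (n%:R%:E + cp K n (relative_step R1 (trsU R2 S)) L).
Proof.
move=> /weight_gap_steps[C HC]; exists C => n.
apply: cp_le => [|m t u Lt tn /HC[k [v [tv mk]]]].
  by rewrite mule_ge0 ?adde_ge0 ?cp_ge0 ?lee_fin.
have kcp := le_cp Lt tn tv.
apply: (@le_trans _ _ (C%:R%:E * (n%:R%:E + k%:R%:E))); last first.
  by rewrite lee_wpmul2l ?lee_fin // leeD2l.
rewrite -EFinD -EFinM lee_fin -natrD -natrM ler_nat.
by apply: leq_trans mk _; rewrite leq_mul2l leq_add2r tn orbT.
Qed.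

End Complexity.

Theorem theorem7p4 (K : realType) (F : Type) (ar : F -> nat) (V : eqType)
    (Phi : cp_problem ar V -> set (cp_problem ar V * (nat -> nat)))
    (Phi_split : forall (R S : trs ar V) (L : set (term ar V)),
       (exists R1 R2, weight_gap_split R S R1 R2) ->
       exists R1 R2, weight_gap_split R S R1 R2 /\
         Phi (CPProblem R S L)
           = [set (CPProblem R1 (trsU R2 S) L, fun n : nat => n)])
    (Phi_id : forall (R S : trs ar V) (L : set (term ar V)),
       ~ (exists R1 R2, weight_gap_split R S R1 R2) ->
       Phi (CPProblem R S L) = [set (CPProblem R S L, fun _ : nat => 0%N)]) :
  is_processor Phi /\ sound K Phi.
Proof.
split=> -[R S L]; have [/(Phi_split _ _ L)[R1 [R2 [gap E]]]|/(Phi_id _ _ L) E] :=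
  EM (exists R1 R2, weight_gap_split R S R1 R2).
- by rewrite E; apply: finite_set1.
- by rewrite E; apply: finite_set1.
- have [C HC] := weight_gap_cp K L gap.
  by exists C, 0 => n _; rewrite E !fsbig_set1; apply: HC.
(* The problem is returned unchanged at cost 0, so both sides coincide. *)
- by exists 1, 0 => n _; rewrite E !fsbig_set1 add0e mul1e.
Qed.
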